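(* (i) For $d=2$ and every $n\ge 4$, there exists a strictly positive polynomial in the boundary of $\Sigma_{n,4}$ that is the sum of squares of $\dim H_{n,2}-6$ linearly independent polynomials in $H_{n,2}$. (ii) For every $d\ge 3$ and every $n\ge 3$, there exists a strictly positive polynomial in the boundary of $\Sigma_{n,2d}$ that is the sum of squares of $\dim H_{n,d}-(3d-2)$ linearly independent polynomials in $H_{n,d}$.
   Context: $H_{n,d}$ denotes the real vector space of homogeneous polynomials of degree $d$ in $n$ variables with coefficients in $\mathbb{R}$ (so $\dim H_{n,d}=\binom{n+d-1}{d}$). $\Sigma_{n,2d}\subset H_{n,2d}$ is the convex cone of polynomials that can be written as a finite sum of squares of polynomials in $H_{n,d}$; its boundary is taken in $H_{n,2d}$. A polynomial $f\in H_{n,2d}$ is strictly positive if $f(x)>0$ for all $x\in\mathbb{R}^n\setminus\{0\}$. *)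

(* Defs.v *)
From HB Require Import structures.
From mathcomp Require Import all_boot all_order all_algebra.
From mathcomp Require Import boolp classical_sets reals topology normedtype.
(* The notations of mpoly are incompatible with those of topology. *)
From mathcomp Require mpoly.
Import -(notations) mpoly.
Import numFieldNormedType.Exports.
Import GRing.Theory VectorInternalTheory.

Set Implicit Arguments.
Unset Strict Implicit.
Unset Printing Implicit Defensive.

Local Open Scope classical_set_scope.
Local Open Scope ring_scope.

(* The canonical topology of a finite-dimensional real vector space, carried
   over from R^(dim V) by the linear bijection v2r; it does not depend on the
   choice of this bijection. *)
Definition euclidean (R : realType) (V : vectType R) : topologicalType :=
  initial_topology (v2r : V -> 'rV[R]_(dim V)).

Definition boundary (R : realType) (V : vectType R) (A : set V) : set V :=
  @closure (euclidean V) A `\` @interior (euclidean V) A.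

(* H_{n,d} is the library's type dhomog n R d, a vectType only when the number
   of variables is a successor; hence n.+1 variables below. *)

Definition sum_of_squares (R : realType) (n d : nat)
    (s : seq (dhomog n.+1 R d)) : mpoly n.+1 R :=
  \sum_(p <- s) (p : mpoly n.+1 R) ^+ 2.

Definition sos_cone (R : realType) (n d : nat) :
    set (dhomog n.+1 R (2 * d)) :=
  [set f | exists s : seq (dhomog n.+1 R d),
             (f : mpoly n.+1 R) = sum_of_squares s].
Arguments sos_cone : clear implicits.

Definition strictly_positive (R : realType) (n d : nat)
    (f : dhomog n.+1 R d) : Prop :=
  forall x : 'rV[R]_n.+1, x != 0 -> 0 < meval (x ord0) f.

Lemma dim_dhomog (R : realType) (n d : nat) :
  \dim {:dhomog n.+1 R d} = 'C(n.+1 + d - 1, d).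
Proof. by rewrite dimvf addSn subn1 addnC. Qed.

(* Main.v *)
From HB Require Import structures.
Require Import Defs.
From mathcomp Require Import all_boot all_order all_algebra.
From mathcomp Require Import boolp classical_sets reals topology normedtype.
From mathcomp Require mpoly.
Import -(notations) mpoly.
From mathcomp Require Import ring.
Import Order.TTheory GRing.Theory Num.Theory numFieldNormedType.Exports.
Import VectorInternalTheory.

(** The polynomial is found as a zero, in the cone, of a linear functional l that
    is nonnegative on squares; such a zero lies on the boundary
    (boundary_of_functional).  The functional is a signed sum of point
    evaluations, with a single negative coefficient.  It exists as soon as the
    values of forms of degree d at a finite set A of points satisfy exactly one
    linear relation, all of whose coefficients are nonzero: the relation
    expresses the value at one point by the values at the others, and the
    negative coefficient is chosen so that the Cauchy-Schwarz inequality makes l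
    nonnegative on squares, with equality on a space of forms of codimension
    #|A| - 2.  The sum of the squares of a basis of this space is the required
    polynomial, provided that all common zeros of the forms vanishing on A are
    proportional to points of A (boundary_sos_of_relation).

    The points are those of a grid, a complete intersection of products of
    linear forms of degrees e k + 1, where the sum of the e k is d + 1.  The
    relation is then the Cayley-Bacharach relation, here an iterated finite
    difference (grid_relation).  It is the only one up to a factor, because two
    neighbouring nodes can be separated from all others by a form of degree d
    (edge_form, grid_relation_unique); and the forms of degree d vanishing on
    the grid have no other common zero (grid_zeros), because e k + 1 <= d.

    A cube, with 8 vertices, serves for d = 2 and a grid of d columns and 3 rows,
    with 3 d nodes, for d >= 3; the other variables vanish on the grid. *)

Set Implicit Arguments.
Unset Strict Implicit.
Unset Printing Implicit Defensive.

Local Open Scope ring_scope.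

(** * Linear functionals *)

(** A nonzero linear functional that is nonnegative on a set has no zero in its
    interior: from an interior zero one can move a little in the direction in
    which the functional decreases. *)
Lemma boundary_of_functional (R : realType) (V : vectType R) (A : set V)
    (l : {scalar V}) (f g : V) :
  A f -> (forall a, A a -> 0 <= l a) -> l f = 0 -> l g != 0 -> boundary A f.
Proof.
move=> Af l_ge0 lf0 lg_neq0; split; first exact: (@subset_closure (euclidean V)).
move=> [B [[C openC <-] Cf]] subA.
(* The direction is taken with the factor l g and followed for negative c, so
   that l changes by c * (l g)^2, whatever the sign of l g. *)
have cont : {for 0, continuous (fun c : R => v2r f + c *: v2r (l g *: g))}.
  apply: cvgD; first exact: cvg_cst.
  by apply: cvgZr_tmp; exact: cvg_id.
have : nbhs (v2r f + 0 *: v2r (l g *: g)) C.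
  by rewrite scale0r addr0; apply: open_nbhs_nbhs.
move=> /cont /= nC.
have [e /= e_gt0 eC] := (@nbhs_ballP R R 0 _).1 nC.
have /eC/= Cc : ball (0 : R) e (- (e / 2)).
  rewrite -ball_normE /= sub0r opprK gtr0_norm ?divr_gt0 //.
  by rewrite ltr_pdivrMr// mulr_natr mulr2n ltrDl.
have /l_ge0 : A (f + (- (e / 2)) *: (l g *: g)).
  by apply: subA; rewrite /preimage/= linearD linearZ.
have lE c b : l (f + c *: (b *: g)) = c * (b * l g).
  by rewrite linearD lf0 add0r !linearZ.
rewrite lE mulNr oppr_ge0.
by apply/negP; rewrite -ltNge mulr_gt0 ?divr_gt0// -expr2 exprn_even_gt0.
Qed.

(** A proper subspace of F^N is annihilated by a nonzero row: here the row
    kernel of the transposed matrix of values of E on a basis. *)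
Lemma limg_full_of_dual (F : fieldType) (V : vectType F) N
    (E : 'Hom(V, 'rV[F]_N)) :
  (forall c : 'rV[F]_N, (forall p, \sum_i c 0 i * E p 0 i = 0) -> c = 0) ->
  limg E = fullv.
Proof.
move=> dualE.
pose M := \matrix_i E (tnth (vbasis {:V}) i).
have full : row_full M.
  rewrite /row_full -mxrank_tr -[_ == _]/(row_free M^T) -kermx_eq0.
  apply/eqP/row_matrixP => i.
  rewrite row0; apply: dualE => p.
  set c := row i _.
  have cM : c *m M^T = 0 by rewrite /c -row_mul mulmx_ker row0.
  clearbody c.
  rewrite (coord_vbasis (memvf p)) linear_sum /=.
  under eq_bigr do rewrite summxE mulr_sumr.
  rewrite exchange_big big1 //= => j _.
  under eq_bigr do rewrite linearZ /= mxE mulrCA.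
  rewrite -mulr_sumr.
  have /matrixP/(_ 0 j) := cM; rewrite !mxE.
  under eq_bigr do rewrite !mxE (tnth_nth 0).
  by move=> ->; rewrite mulr0.
apply/eqP; rewrite eqEsubv subvf /=; apply/subvP => w _.
have /submxP[D ->] := submx_full w full.
rewrite mulmx_sum_row memv_suml // => j _.
by rewrite rowK memvZ // memv_img ?memvf.
Qed.

(** Independent functionals take arbitrary prescribed values, and each of them
    cuts the dimension of their common kernel by one. *)
Lemma independent_functionals (F : fieldType) (V : vectType F) (I : finType)
    (A : {set I}) (phi : I -> {scalar V}) :
  (forall c : I -> F, (forall p, \sum_(v in A) c v * phi v p = 0) ->
     {in A, forall v, c v = 0}) ->
  (forall y : I -> F, exists p, {in A, forall v, phi v p = y v}) /\
  (exists2 K : {vspace V},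
     forall p, p \in K <-> {in A, forall v, phi v p = 0} &
     (\dim K + #|A| = \dim {:V})%N).
Proof.
move=> indep.
pose sample p : 'rV[F]_#|A| := \row_i phi (enum_val i) p.
have sample_lin : linear sample.
  by move=> c p q; apply/rowP => i; rewrite !mxE linearP.
pose sampleL : {linear V -> 'rV[F]_#|A|} :=
  HB.pack sample (GRing.isLinear.Build F V 'rV[F]_#|A| _ sample sample_lin).
have full : limg (linfun sampleL) = fullv.
  apply: limg_full_of_dual => c c_orth.
  (* Coefficients indexed by the enumeration of A, read back on I; the sum has
     one term if v is in A, and none otherwise. *)
  pose c' v := \sum_(i | enum_val i == v) c 0 i.
  have c'E i : c' (enum_val i) = c 0 i.
    by apply: big_pred1 => j; rewrite (inj_eq enum_val_inj).
  apply/rowP => i; rewrite mxE -c'E; apply: indep (enum_valP i) => p.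
  rewrite -[RHS](c_orth p) big_enum_val; apply: eq_bigr => j _.
  by rewrite c'E lfunE mxE.
split=> [y|].
  have /memv_imgP[p _ yE] : \row_i y (enum_val i) \in limg (linfun sampleL).
    by rewrite full memvf.
  exists p => v Av; have /rowP/(_ (enum_rank_in Av v)) := yE.
  by rewrite lfunE !mxE enum_rankK_in.
exists (lker (linfun sampleL)) => [p|].
  rewrite memv_ker lfunE; split=> [/eqP/rowP p0 v Av|p0].
    by have := p0 (enum_rank_in Av v); rewrite !mxE enum_rankK_in.
  by apply/eqP/rowP => i; rewrite !mxE p0 ?enum_valP.
have := limg_ker_dim (linfun sampleL) {:V}.
by rewrite full capfv dimvf /dim /= mul1n.
Qed.

(** * Sums of squares and point evaluations *)

Section Evaluation.
Variables (R : realType) (n d : nat).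
Implicit Types (x : 'rV[R]_n.+1) (p : dhomog n.+1 R d).

Definition eval_form x p : R := meval (x ord0) p.

Lemma eval_form_is_linear x : linear_for *%R (eval_form x).
Proof.
move=> c p q.
by rewrite /eval_form mpoly_of_dhomog_is_linear mevalD mevalZ.
Qed.

HB.instance Definition _ x :=
  GRing.isLinear.Build R (dhomog n.+1 R d) R *%R (eval_form x)
    (eval_form_is_linear x).

Lemma eval_formE x p :
  eval_form x p = \sum_(m <- msupp p) mcoeff m p * \prod_i x 0 i ^+ m i.
Proof. exact: mevalE. Qed.

Lemma mdeg_msupp p m : m \in msupp p -> mdeg m = d.
Proof. by have /dhomogP h := dhomog_is_dhomog p; apply: h. Qed.

Lemma eval_form_scale t x p : eval_form (t *: x) p = t ^+ d * eval_form x p.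
Proof.
rewrite !eval_formE mulr_sumr !big_seq; apply: eq_bigr => m /mdeg_msupp degm.
rewrite mulrCA -[in t ^+ _]degm mdegE -prodrXr; congr (_ * _).
by rewrite -big_split; apply: eq_bigr => i _; rewrite mxE exprMn.
Qed.

Lemma sum_of_squares_homog (s : seq (dhomog n.+1 R d)) :
  sum_of_squares s \is ishomog1 (2 * d) mdeg.
Proof.
apply: rpred_sum => p _; rewrite mulnC.
exact/dhomogMn/dhomog_is_dhomog.
Qed.

Definition sos_form s : dhomog n.+1 R (2 * d) :=
  DHomog (sum_of_squares_homog s).

End Evaluation.

Lemma eval_sos (R : realType) (n d : nat) (x : 'rV[R]_n.+1)
    (f : dhomog n.+1 R (2 * d)) (s : seq (dhomog n.+1 R d)) :
  (f : mpoly n.+1 R) = sum_of_squares s ->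
  eval_form x f = \sum_(p <- s) eval_form x p ^+ 2.
Proof.
rewrite /eval_form => ->; rewrite raddf_sum; apply: eq_bigr => p _.
exact: rmorphXn.
Qed.

Lemma strictly_positive_sos (R : realType) (n d : nat)
    (s : seq (dhomog n.+1 R d)) :
  (forall x : 'rV[R]_n.+1, {in s, forall p, eval_form x p = 0} -> x = 0) ->
  strictly_positive (sos_form s).
Proof.
move=> no_zero x; rewrite lt0r -[meval _ _]/(eval_form x (sos_form s)).
rewrite (@eval_sos _ _ _ x _ s)// => x_neq0.
rewrite sumr_ge0 ?andbT => [|p _]; last exact: sqr_ge0.
apply: contraNneq x_neq0 => /eqP.
rewrite big_seq psumr_eq0 => [/allP sq0|p _]; last exact: sqr_ge0.
apply/eqP/no_zero => p ps; apply/eqP.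
by have := sq0 p ps; rewrite ps /= sqrf_eq0.
Qed.

(** The extreme functional attached to a set of points A at which the values of
    forms of degree d satisfy exactly one linear relation, with nonzero
    coefficients u.  Put A' = A minus v0, S = sum of u_v^2 over A', and
      l f = (sum over A' of f(P_v)) - (u_v0^2 / S) f(P_v0).
    By the relation, u_v0 p(P_v0) = - T p with T p = sum over A' of u_v p(P_v),
    so l (p^2) = (sum over A' of p(P_v)^2) - (T p)^2 / S, which is nonnegative
    by the Cauchy-Schwarz inequality and vanishes exactly when the values of p
    on A' are proportional to u.  These p form a space of dimension
    dim - (#|A| - 2): the forms vanishing on A' (equivalently on A, by the
    relation), plus one form pc with pc(P_v) = u_v on A'.  The sum of the
    squares of a basis is a zero of l in the cone.  It is strictly positive,
    because a common zero of the forms vanishing on A is proportional to some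
    P_v, where pc does not vanish. *)
Lemma boundary_sos_of_relation (R : realType) (n d : nat) (I : finType)
    (A : {set I}) (P : I -> 'rV[R]_n.+1) (u : I -> R) (v0 : I) :
  v0 \in A -> (2 < #|A|)%N -> {in A, forall v, u v != 0} ->
  (forall p : dhomog n.+1 R d, \sum_(v in A) u v * eval_form (P v) p = 0) ->
  (forall c : I -> R,
    (forall p : dhomog n.+1 R d, \sum_(v in A) c v * eval_form (P v) p = 0) ->
    c v0 = 0 -> {in A, forall v, c v = 0}) ->
  (forall x,
    (forall p : dhomog n.+1 R d,
       {in A, forall v, eval_form (P v) p = 0} -> eval_form x p = 0) ->
    x != 0 -> exists2 v, v \in A & exists2 t, t != 0 & x = t *: P v) ->
  exists f : dhomog n.+1 R (2 * d),
    [/\ strictly_positive f, boundary (sos_cone R n d) f &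
        exists s : (\dim {:dhomog n.+1 R d} - (#|A| - 2)).-tuple
                     (dhomog n.+1 R d),
          free s /\ (f : mpoly n.+1 R) = sum_of_squares s].
Proof.
move=> Av0 A_gt2 u_neq0 relation relation_unique zeros.
pose A' := A :\ v0.
have cardA : #|A| = #|A'|.+1 by rewrite (cardsD1 v0) Av0.
have A'A v : v \in A' -> v \in A by rewrite in_setD1 => /andP[].
have splitA (c : I -> R) (p : dhomog n.+1 R d) :
    \sum_(v in A) c v * eval_form (P v) p =
    c v0 * eval_form (P v0) p + \sum_(v in A') c v * eval_form (P v) p.
  rewrite (bigD1 v0) //=; congr (_ + _); apply: eq_bigl => v.
  by rewrite in_setD1 andbC.
have [|interp [K KE dimK]] := @independent_functionals R (dhomog n.+1 R d) I A'
    (fun v => eval_form (P v)).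
  move=> c c_orth v; rewrite in_setD1 => /andP[v_neq Av].
  have := relation_unique (fun v => if v == v0 then 0 else c v).
  rewrite eqxx => /(_ _ erefl v Av); rewrite (negPf v_neq); apply=> p.
  rewrite splitA eqxx mul0r add0r -[RHS](c_orth p); apply: eq_bigr => w.
  by rewrite in_setD1 => /andP[/negPf-> _].
have [pc pcE] := interp u.
pose T (p : dhomog n.+1 R d) := \sum_(v in A') u v * eval_form (P v) p.
pose S := \sum_(v in A') u v ^+ 2.
have TE p : u v0 * eval_form (P v0) p = - T p.
  by apply/eqP; rewrite -addr_eq0 -splitA relation.
have Tpc : T pc = S by apply: eq_bigr => v /pcE ->.
have A'_gt1 : (1 < #|A'|)%N by rewrite -ltnS -cardA.
have [v1 [v2 [A'v1 A'v2 v12]]] := card_gt1P A'_gt1.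
have S_gt : u v1 ^+ 2 < S.
  rewrite /S (bigD1 v1)//= ltrDl (bigD1 v2) /=; last by rewrite A'v2 eq_sym.
  apply: ltr_pwDl; first by rewrite exprn_even_gt0 ?u_neq0 ?A'A.
  by apply: sumr_ge0 => *; exact: sqr_ge0.
have S_gt0 : 0 < S by apply: le_lt_trans S_gt; exact: sqr_ge0.
pose s := pc :: vbasis K.
have size_s : size s = (\dim {:dhomog n.+1 R d} - (#|A| - 2))%N.
  rewrite /= size_tuple -dimK cardA subSS; case: #|A'| A'_gt1 => // k _.
  by rewrite subSS subn0 addnS subSn ?leq_addl// addnK.
have spanK := span_basis (vbasisP K).
have pc_v v : v \in A -> eval_form (P v) pc != 0.
  move=> Av; case: (eqVneq v v0) => [->|v_neq]; last first.
    by rewrite pcE ?u_neq0 // in_setD1 v_neq.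
  suff : u v0 * eval_form (P v0) pc != 0 by rewrite mulf_eq0 negb_or => /andP[].
  by rewrite TE Tpc oppr_eq0 gt_eqF.
have free_s : free s.
  rewrite free_cons (basis_free (vbasisP K)) andbT spanK.
  apply/negP => /KE/(_ v1 A'v1) pc0.
  by have := pc_v v1 (A'A _ A'v1); rewrite pc0 eqxx.
exists (sos_form s); split.
- apply: strictly_positive_sos => x s0; apply: contraTeq isT => x_neq0.
  have [p pA|v Av [t t_neq0 xE]] := zeros x _ x_neq0.
    have /coord_vbasis-> : p \in K by apply/KE => v /A'A; exact: pA.
    rewrite linear_sum big1 // => i _; rewrite linearZ /= s0 ?mulr0 //.
    by rewrite inE mem_nth ?orbT // size_tuple.
  have := s0 pc (mem_head _ _); rewrite xE eval_form_scale => /eqP.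
  by rewrite mulf_eq0 expf_eq0 (negPf t_neq0) andbF (negPf (pc_v v Av)).
- pose Q (p : dhomog n.+1 R d) :=
    \sum_(v in A') eval_form (P v) p ^+ 2 - T p ^+ 2 / S.
  pose lf (f : dhomog n.+1 R (2 * d)) : R :=
    \sum_(v in A') eval_form (P v) f - u v0 ^+ 2 / S * eval_form (P v0) f.
  have lf_lin : linear_for *%R lf.
    move=> c f g; rewrite /lf linearP.
    under eq_bigr do rewrite linearP.
    rewrite big_split -mulr_sumr /=; ring.
  pose l : {scalar dhomog n.+1 R (2 * d)} :=
    HB.pack lf (GRing.isLinear.Build R (dhomog n.+1 R (2 * d)) R _ lf lf_lin).
  have lE (f : dhomog n.+1 R (2 * d)) (t : seq (dhomog n.+1 R d)) :
      (f : mpoly n.+1 R) = sum_of_squares t -> l f = \sum_(p <- t) Q p.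
    move=> fE; rewrite -[l f]/(lf f) /lf (eval_sos _ fE).
    under eq_bigr do rewrite (eval_sos _ fE).
    rewrite exchange_big mulr_sumr -sumrB; apply: eq_bigr => p _.
    rewrite /Q; congr (_ - _); rewrite -[in RHS]sqrrN -TE exprMn; ring.
  (* The Cauchy-Schwarz defect is the squared norm of the component orthogonal
     to u of the vector of the values of p on A'. *)
  have Q_ge0 p : 0 <= Q p.
    have -> : Q p = \sum_(v in A') (eval_form (P v) p - T p / S * u v) ^+ 2.
      rewrite [RHS](eq_bigr (fun v => eval_form (P v) p ^+ 2
          - 2 * (T p / S) * (u v * eval_form (P v) p)
          + (T p / S) ^+ 2 * u v ^+ 2)); last by move=> v _; ring.
      rewrite big_split sumrB /= -!mulr_sumr -/S -/(T p) /Q; field.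
      by rewrite gt_eqF.
    by apply: sumr_ge0 => *; exact: sqr_ge0.
  (* To see that l is nonzero, use a form whose values on A' are not
     proportional to u; two points in A' are enough for that. *)
  have [q qE] := interp (fun v => (v == v1)%:R).
  apply: (@boundary_of_functional _ _ _ l _ (sos_form [:: q])).
  + by exists s.
  + by move=> f [t fE]; rewrite (lE _ _ fE) sumr_ge0.
  + rewrite (lE _ s)// big_cons big_seq big1 ?addr0.
      rewrite /Q Tpc expr2 mulfK ?gt_eqF //; apply/eqP; rewrite subr_eq0.
      by apply/eqP; apply: eq_bigr => v /pcE ->.
    move=> p /vbasis_mem /KE p0; rewrite /Q /T !big1 ?expr0n ?mul0r ?subr0 //.
      by move=> v /p0->; rewrite mulr0.
    by move=> v /p0->; rewrite expr0n.
  + rewrite (lE _ [:: q])// big_seq1 /Q /T (bigD1 v1)//= qE // eqxx.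
    rewrite big1 => [|v /andP[A'v /negPf vv1]]; last by rewrite qE// vv1 expr0n.
    rewrite (bigD1 v1)//= qE // eqxx.
    rewrite big1 => [|v /andP[A'v /negPf vv1]]; last by rewrite qE// vv1 mulr0.
    rewrite !addr0 expr1n mulr1 subr_eq0 eq_sym lt_eqF //.
    by rewrite ltr_pdivrMr ?mul1r.
- have sizeP : size s == (\dim {:dhomog n.+1 R d} - (#|A| - 2))%N.
    by rewrite size_s.
  by exists (Tuple sizeP).
Qed.

(** * Grids of points *)

(** The m-th finite difference kills polynomials of degree less than m.  Since
    i * C(m, i) = m * C(m - 1, i - 1), lowering the exponent by one turns the
    sum for m into sums for m - 1, after expansion of (i + 1)^k. *)
Lemma alternating_binomial_sum (R : comNzRingType) (m k : nat) :
  (k < m)%N -> \sum_(i < m.+1) (-1) ^+ i * 'C(m, i)%:R * i%:R ^+ k = 0 :> R.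
Proof.
elim: m k => // m IHm [|k] k_lt.
  have /esym := exprBn (1 : R) 1 m.+1; rewrite subrr expr0n => sum0.
  rewrite -[RHS]sum0; apply: eq_bigr => i _.
  by rewrite expr0 !expr1n !mulr1 mulr_natr.
rewrite big_ord_recl /= expr0n mulr0 add0r.
transitivity (- m.+1%:R * \sum_(i < m.+1)
    (-1) ^+ i * 'C(m, i)%:R * (i%:R + 1) ^+ k : R).
  rewrite mulr_sumr; apply: eq_bigr => i _.
  rewrite /bump /= add1n -natr1 exprS [_ ^+ k.+1]exprS.
  have : m.+1%:R * 'C(m, i)%:R = (i%:R + 1) * 'C(m.+1, i.+1)%:R :> R.
    by rewrite -natrM mul_bin_diag natrM natr1.
  move: m.+1%:R ('C(m, i)%:R) ('C(m.+1, i.+1)%:R) (i%:R : R) => M B B1 j binE.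
  by ring: binE.
under eq_bigr do rewrite exprD1n mulr_sumr.
rewrite exchange_big big1 ?mulr0 // => l _ /=.
under eq_bigr do rewrite mulrnAr.
by rewrite sumrMnl IHm ?mul0rn // (leq_trans (ltn_ord l)).
Qed.

Section Grid.
Variables (R : realType) (n d : nat) (e : 'I_n -> nat).
Hypothesis e_lt : forall k, (e k < d)%N.
Hypothesis sum_e : (\sum_k e k)%N = d.+1.

Let I := {ffun 'I_n -> 'I_d}.
Implicit Types (g h : I) (k : 'I_n) (x : 'rV[R]_n.+1).

Definition nodes k : {set 'I_d} := [set j : 'I_d | (j <= e k)%N].
Definition grid : {set I} := [set g | g \in family (fun k => mem (nodes k))].

(** The coordinate of index ord0 is the homogenizing one. *)
Definition grid_point g : 'rV[R]_n.+1 :=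
  \row_i if unlift ord0 i is Some k then (g k)%:R else 1.

(** The tensor product of the weights of the finite differences of order e k in
    the direction k. *)
Definition grid_weight g : R :=
  \prod_k ((-1) ^+ g k * 'C(e k, g k)%:R).

Lemma in_grid g : reflect (forall k, g k \in nodes k) (g \in grid).
Proof. by rewrite inE; apply: familyP. Qed.

Lemma card_nodes k : #|nodes k| = (e k).+1.
Proof.
rewrite -sum1_card (eq_bigl (fun j : 'I_d => j < (e k).+1)%N) => [|j].
  by rewrite -(big_ord_widen _ (fun=> 1%N)) ?sum_nat_const ?card_ord ?muln1.
by rewrite inE.
Qed.

Lemma card_grid : #|grid| = (\prod_k (e k).+1)%N.
Proof.
rewrite cardsE card_family foldrE big_image /=.
by apply: eq_bigr => k _; rewrite -card_nodes.
Qed.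

Lemma grid_point0 g : grid_point g 0 ord0 = 1.
Proof. by rewrite mxE unlift_none. Qed.

Lemma grid_pointS g k : grid_point g 0 (lift ord0 k) = (g k)%:R.
Proof. by rewrite mxE liftK. Qed.

Lemma grid_weight_neq0 g : g \in grid -> grid_weight g != 0.
Proof.
move=> /in_grid gP; apply/prodf_neq0 => k _.
rewrite mulf_neq0 ?signr_eq0 // pnatr_eq0 -lt0n bin_gt0.
by have := gP k; rewrite inE.
Qed.

(** The Cayley-Bacharach relation of the grid.  On a monomial the weighted sum
    factors into finite differences of order e k of j^(m_k); as the degree d is
    less than the sum of the e k, some exponent m_k is less than e k and its
    factor is zero. *)
Lemma grid_relation (p : dhomog n.+1 R d) :
  \sum_(g in grid) grid_weight g * eval_form (grid_point g) p = 0.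
Proof.
under eq_bigr do rewrite eval_formE mulr_sumr.
rewrite exchange_big big_seq big1 //= => m /mdeg_msupp.
rewrite mdegE big_ord_recl => deg_m.
have [k m_lt] : exists k, (m (lift ord0 k) < e k)%N.
  apply/existsP/contraT; rewrite negb_exists => /forallP m_ge.
  have : (\sum_k e k <= \sum_k m (lift ord0 k))%N.
    by apply: leq_sum => k _; rewrite leqNgt.
  by rewrite sum_e -deg_m ltnNge leq_addl.
pose w k j : R := (-1) ^+ j * 'C(e k, j)%:R * j%:R ^+ m (lift ord0 k).
under eq_bigr => g _.
  rewrite mulrCA big_ord_recl grid_point0 expr1n mul1r -big_split /=.
  rewrite (eq_bigr (fun k => w k (g k))); last by move=> j _; rewrite grid_pointS.
  over.
rewrite -mulr_sumr (eq_bigl (mem (family (fun k => mem (nodes k)))));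
  last by move=> g; rewrite inE.
rewrite -(bigA_distr_big_dep (fun k j => j \in nodes k) (fun k j => w k j)).
rewrite (bigD1 k) //= [X in _ * (X * _)](_ : _ = 0) ?mul0r ?mulr0 //.
rewrite (eq_bigl (fun j : 'I_d => j < (e k).+1)%N) => [|j]; last by rewrite inE.
by rewrite -(big_ord_widen _ (w k)) // alternating_binomial_sum.
Qed.

Definition grid_factor k (j : nat) : mpoly n.+1 R :=
  mpolyX R (mnm1 (lift ord0 k)) - j%:R *: mpolyX R (mnm1 ord0).

Lemma meval_grid_factor x k j :
  meval (x ord0) (grid_factor k j) = x 0 (lift ord0 k) - j%:R * x 0 ord0.
Proof. by rewrite mevalB mevalZ !mevalXU. Qed.

Lemma grid_factor_homog k j : grid_factor k j \is ishomog1 1 mdeg.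
Proof. by rewrite rpredB ?rpredZ // dhomogX /= mdeg1. Qed.

Lemma prod_homog (T : finType) (Q : pred T) (deg : T -> nat)
    (F : T -> mpoly n.+1 R) :
  (forall i, F i \is ishomog1 (deg i) mdeg) ->
  \prod_(i | Q i) F i \is ishomog1 (\sum_(i | Q i) deg i)%N mdeg.
Proof.
move=> homF; elim/big_rec2: _ => [|i a b _ homb]; first exact: dhomog1.
exact: dhomogM.
Qed.

Definition line_product k (B : {set 'I_d}) := \prod_(j in B) grid_factor k j.

Lemma line_product_homog k (B : {set 'I_d}) :
  line_product k B \is ishomog1 #|B| mdeg.
Proof.
by rewrite -sum1_card; apply: prod_homog => j; exact: grid_factor_homog.
Qed.

Lemma meval_line_product x k (B : {set 'I_d}) :
  meval (x ord0) (line_product k B) =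
  \prod_(j in B) (x 0 (lift ord0 k) - j%:R * x 0 ord0).
Proof.
by rewrite rmorph_prod; apply: eq_bigr => j _; exact: meval_grid_factor.
Qed.

Lemma line_product_eq0 g k (B : {set 'I_d}) :
  (meval (grid_point g ord0) (line_product k B) == 0) = (g k \in B).
Proof.
rewrite meval_line_product grid_pointS grid_point0.
apply/prodf_eq0/idP => [[j jB]|gB]; last by exists (g k); rewrite ?mulr1 ?subrr.
by rewrite mulr1 subr_eq0 eqr_nat => /eqP/val_inj->.
Qed.

(** Two neighbours g and h on a line of the grid are separated from all the
    other nodes by a form of degree d: multiply, in each direction k, the linear
    forms of the coordinate values other than g k and h k.  There are e k of
    them, and one less in the direction of the line, hence d in all. *)
Lemma edge_form g h k0 :
  g \in grid -> h \in grid -> g k0 != h k0 -> {in predC1 k0, g =1 h} ->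
  exists q : dhomog n.+1 R d, {in grid, forall f,
    (eval_form (grid_point f) q == 0) = (f != g) && (f != h)}.
Proof.
move=> /in_grid gP /in_grid hP gh0 ghE.
pose B k := nodes k :\: [set g k; h k].
have cardB k : #|B k| = (e k - (k == k0))%N.
  rewrite cardsD (finset.setIidPr _) ?card_nodes; last first.
    by apply/fintype.subsetP => j /finset.set2P[] ->.
  rewrite cards2; case: (eqVneq k k0) => [->|k_neq]; first by rewrite gh0 subSS.
  by rewrite ghE // eqxx subn1 subn0.
have homq : \prod_k line_product k (B k) \is ishomog1 d mdeg.
  suff <- : (\sum_k #|B k| = d)%N.
    by apply: prod_homog => k; exact: line_product_homog.
  have e_k0 : (0 < e k0)%N.
    rewrite lt0n; apply: contraNneq gh0 => e0; rewrite -val_eqE /=.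
    by have := gP k0; have := hP k0; rewrite !inE e0 !leqn0 => /eqP-> /eqP->.
  apply: succn_inj; rewrite -sum_e (bigD1 k0) //= [RHS](bigD1 k0) //=.
  rewrite cardB eqxx subn1 -addSn prednK //; congr (_ + _)%N.
  by apply: eq_bigr => k /negPf k_neq; rewrite cardB k_neq subn0.
exists (DHomog homq) => f /in_grid fP; rewrite /eval_form /= rmorph_prod -negb_or.
apply/prodf_eq0/idP => [[k _]|].
  rewrite line_product_eq0 !inE => /andP[fk _]; apply: contra fk.
  by move=> /orP[/eqP->|/eqP->]; rewrite eqxx ?orbT.
move=> f_neq.
have [/existsP[k Bk]|] := boolP [exists k, f k \notin [set g k; h k]].
  by exists k; rewrite // line_product_eq0 inE Bk fP.
rewrite negb_exists => /forallP fgh; case/negP: f_neq.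
have ff k : k != k0 -> f k = g k.
  by move=> k_neq; have := fgh k; rewrite !inE negbK -ghE // orbb => /eqP.
have := fgh k0; rewrite !inE negbK => /orP[/eqP f0|/eqP f0]; apply/orP.
  left; apply/eqP/ffunP => k; case: (eqVneq k k0) => [->//|]; exact: ff.
right; apply/eqP/ffunP => k; case: (eqVneq k k0) => [->//|k_neq].
by rewrite ff // ghE.
Qed.

(** A relation applied to the edge form of two neighbours involves only their
    two coefficients; so if one coefficient is zero, the zero propagates along
    the edges of the grid, which is connected. *)
Lemma grid_relation_unique (c : I -> R) (g0 : I) :
  (forall p : dhomog n.+1 R d,
     \sum_(g in grid) c g * eval_form (grid_point g) p = 0) ->
  (forall k, g0 k = 0 :> nat) -> c g0 = 0 -> {in grid, forall g, c g = 0}.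
Proof.
move=> c_rel g0E cg0 g; elim: {g}_.+1 {-2}g (ltnSn (\sum_k g k)) => // b IHb g.
rewrite ltnS => g_le gA.
have [/eqP|] := eqVneq (\sum_k g k)%N 0%N.
  rewrite sum_nat_eq0 => /forallP/= gE.
  suff -> : g = g0 by [].
  by apply/ffunP => k; apply/val_inj; rewrite /= g0E; exact/eqP.
rewrite sum_nat_eq0 negb_forall => /existsP[k0 /= gk0].
have pred_lt : ((g k0).-1 < d)%N by rewrite (leq_ltn_trans (leq_pred _)).
pose h : I := [ffun k => if k == k0 then Ordinal pred_lt else g k].
have hE : {in predC1 k0, g =1 h} by move=> k /negPf k_neq; rewrite ffunE k_neq.
have h0 : h k0 = (g k0).-1 :> nat by rewrite ffunE eqxx.
have gh0 : g k0 != h k0 by rewrite -val_eqE /= h0 neq_ltn ltn_predL lt0n gk0 orbT.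
have hA : h \in grid.
  apply/in_grid => k; have /in_grid/(_ k) := gA; rewrite !inE ffunE.
  by case: eqP => [->|//]; apply: leq_trans; exact: leq_pred.
have h_lt : (\sum_k h k < b)%N.
  apply: leq_trans g_le; rewrite (bigD1 k0) //= [X in (_ < X)%N](bigD1 k0) //=.
  rewrite h0 (eq_bigr (fun k => val (g k))) => [|k k_neq]; last by rewrite hE.
  by rewrite ltn_add2r ltn_predL lt0n.
have ch := IHb h h_lt hA.
have [q qE] := edge_form gA hA gh0 hE.
have := c_rel q; rewrite (bigD1 g) //= big1 ?addr0 => [/eqP|f /andP[fA f_neq]].
  by rewrite mulf_eq0 qE // eqxx orbF => /eqP.
have [->|fh] := eqVneq f h; first by rewrite ch mul0r.
by have /eqP-> : eval_form (grid_point f) q == 0; rewrite ?mulr0 // qE // f_neq.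
Qed.

(** The grid is cut out by the products of e k + 1 linear forms, one product
    for each direction k; these are raised to degree d by a power of a
    coordinate that is nonzero at x. *)
Lemma grid_zeros x :
  (forall p : dhomog n.+1 R d,
     {in grid, forall g, eval_form (grid_point g) p = 0} -> eval_form x p = 0) ->
  x != 0 -> exists2 g, g \in grid & exists2 t, t != 0 & x = t *: grid_point g.
Proof.
move=> x_zero /rV0Pn[i xi].
have /fin_all_exists[g gP] k :
    exists j, j \in nodes k /\ x 0 (lift ord0 k) = j%:R * x 0 ord0.
  have homp : line_product k (nodes k)
      * mpolyX R (mnm1 i) ^+ (d - (e k).+1) \is ishomog1 d mdeg.
    rewrite -[in ishomog1 d](subnKC (e_lt k)); apply: dhomogM.
      by rewrite -card_nodes line_product_homog.
    by rewrite -[X in ishomog1 X]mul1n dhomogMn // dhomogX /= mdeg1.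
  have := x_zero (DHomog homp); rewrite /eval_form /= mevalM rmorphXn /= mevalXU.
  move=> /(_ _)/eqP; rewrite mulf_eq0 expf_eq0 (negPf xi) andbF orbF.
  rewrite meval_line_product => /(_ _)/prodf_eq0[|j jB].
    move=> g /in_grid gP; apply/eqP; rewrite mevalM mulf_eq0.
    by rewrite line_product_eq0 gP.
  by rewrite subr_eq0 => /eqP; exists j.
exists [ffun k => g k]; first by apply/in_grid => k; rewrite ffunE; case: (gP k).
have xE : x = x 0 ord0 *: grid_point [ffun k => g k].
  apply/rowP => l; rewrite mxE; case: (unliftP ord0 l) => [k|] ->.
    by rewrite grid_pointS ffunE mulrC; case: (gP k).
  by rewrite grid_point0 mulr1.
exists (x 0 ord0) => //; apply: contraNneq xi => x0.
by rewrite xE x0 scale0r mxE.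
Qed.

End Grid.

(** * The theorem *)

(** The general form of both parts: a grid whose side lengths e k + 1 are at
    most d and satisfy sum of e k = d + 1.  Directions with e k = 0 are allowed;
    they put the remaining coordinates to zero, which embeds a
    lower-dimensional grid in n + 1 variables. *)
Lemma boundary_sos_of_grid (R : realType) (n d : nat) (e : 'I_n -> nat) :
  (forall k, (e k < d)%N) -> (\sum_k e k)%N = d.+1 ->
  exists f : dhomog n.+1 R (2 * d),
    [/\ strictly_positive f, boundary (sos_cone R n d) f &
        exists s : (\dim {:dhomog n.+1 R d} - (\prod_k (e k).+1 - 2)).-tuple
                     (dhomog n.+1 R d),
          free s /\ (f : mpoly n.+1 R) = sum_of_squares s].
Proof.
move=> e_lt sum_e.
have d_gt0 : (0 < d)%N.
  case: d e_lt sum_e => // e_lt; rewrite big1 // => k _.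
  by have := e_lt k.
pose g0 : {ffun 'I_n -> 'I_d} := [ffun=> Ordinal d_gt0].
have g0E k : g0 k = 0%N :> nat by rewrite ffunE.
have prod_gt : (\sum_k e k < \prod_k (e k).+1)%N.
  elim/big_rec2: _ => // k a b _ ab.
  by rewrite mulSn -addnS addnC leq_add // leq_pmulr // (leq_trans _ ab).
rewrite -(card_grid e_lt).
apply: (@boundary_sos_of_relation R n d _ _ (@grid_point R n d)
          (@grid_weight R n d e) g0).
- by apply/in_grid => k; rewrite inE g0E.
- by rewrite (card_grid e_lt) (leq_ltn_trans _ prod_gt) // sum_e ltnS.
- exact: grid_weight_neq0.
- exact: grid_relation.
- move=> c c_rel; exact: (grid_relation_unique e_lt sum_e c_rel).
- exact: grid_zeros.
Qed.

Local Close Scope ring_scope.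

Theorem proposition4p17 (R : realType) :
  (forall n : nat, (4 <= n.+1)%N ->
     exists f : dhomog n.+1 R (2 * 2),
       [/\ strictly_positive f,
           boundary (sos_cone R n 2) f &
           exists s : (\dim {:dhomog n.+1 R 2} - 6).-tuple (dhomog n.+1 R 2),
             free s /\ (f : mpoly n.+1 R) = sum_of_squares s]) /\
  (forall d n : nat, (3 <= d)%N -> (3 <= n.+1)%N ->
     exists f : dhomog n.+1 R (2 * d),
       [/\ strictly_positive f,
           boundary (sos_cone R n d) f &
           exists s :
             (\dim {:dhomog n.+1 R d} - (3 * d - 2)).-tuple (dhomog n.+1 R d),
             free s /\ (f : mpoly n.+1 R) = sum_of_squares s]).
Proof.
split=> [[|[|[|n]]] // _|d [|[|n]] // d_ge3 _].
  (* The vertices of a cube: 8 - 2 = 6. *)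
- pose e (k : 'I_n.+3) := nth 0%N [:: 1; 1; 1]%N k.
  have e0 k : e (lift ord0 (lift ord0 (lift ord0 k))) = 0%N.
    by rewrite /e /= nth_nil.
  have -> : 6%N = (\prod_k (e k).+1 - 2)%N.
    by rewrite !big_ord_recl big1 // => k _; rewrite e0.
  apply: boundary_sos_of_grid => [[[|[|[|k]]] k_lt]|] //.
    by rewrite /e /= nth_nil.
  by rewrite !big_ord_recl big1 // => k _; rewrite e0.
  (* A planar grid of d columns and 3 rows: 3 d - 2. *)
- pose e (k : 'I_n.+2) := nth 0%N [:: d.-1; 2]%N k.
  have e0 k : e (lift ord0 (lift ord0 k)) = 0%N by rewrite /e /= nth_nil.
  have d_gt0 : (0 < d)%N by exact: ltnW (ltnW d_ge3).
  have -> : (3 * d - 2)%N = (\prod_k (e k).+1 - 2)%N.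
    rewrite !big_ord_recl big1 => [|k _]; last by rewrite e0.
    by rewrite /e /= muln1 prednK // mulnC.
  apply: boundary_sos_of_grid => [[[|[|k]] k_lt]|] //.
  + by rewrite /e /= prednK.
  + by rewrite /e /= nth_nil.
  + rewrite !big_ord_recl big1 => [|k _]; last by rewrite e0.
    by rewrite /e /= addn0 -addSnnS prednK // addn1.
Qed.
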